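(* Let $n\ge1$, $m=3^{n-1}$, and let $F=F_{m,3}$ be the firecracker graph with vertices $a_r,c_r,b_r$ ($1\le r\le m$) and edges $a_rc_r$, $c_rb_r$ ($1\le r\le m$) and $a_ra_{r+1}$ ($1\le r\le m-1$). Label $a_r,c_r,b_r$ by $3(r-1),3(r-1)+1,3(r-1)+2$ (preorder labeling), and let $lex:V(Q_n^3)\to V(F)$ send $(x_{n-1},\dots,x_0)$ to the vertex labeled $\sum_ix_i3^i$. Then $WL_{lex}(Q_n^3,F)=WL(Q_n^3,F)$, i.e. this embedding has minimum wirelength.
   Context: $Q_n^3$ is the graph on $\{0,1,2\}^n$ in which two tuples are adjacent iff they differ in exactly one coordinate $j$ and there $x_j\equiv y_j\pm1\pmod 3$. For a bijection $f:V(G)\to V(T)$ into a tree $T$, $WL_f(G,T)$ is the sum over edges $(u,v)$ of $G$ of the distance in $T$ between $f(u)$ and $f(v)$ (each edge routed along the unique tree path), and $WL(G,T)=\min_f WL_f(G,T)$. *)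

(* Defs.v *)
From HB Require Import structures.
From mathcomp Require Import all_boot.
From mathcomp Require Import zify.
Set Implicit Arguments. Unset Strict Implicit. Unset Printing Implicit Defensive.

Record graph := Graph {
  vert :> finType;
  adj : rel vert;
  adj_sym : symmetric adj;
  adj_irrefl : irreflexive adj }.

(* Length of a shortest walk from x to y; it is #|G| when there is none. *)
Definition gdist (G : graph) (x y : G) : nat :=
  find (fun k => [exists p : k.-tuple G, path (@adj G) x p && (last x p == y)])
       (iota 0 #|G|).

Lemma gdist_le (G : graph) (x : G) (p : seq G) :
  path (@adj G) x p -> gdist x (last x p) <= size p.
Proof.
move=> pp; rewrite /gdist; set a := (fun k => _).
case: (ltnP (size p) #|G|) => h; last first.
  by apply: leq_trans (find_size _ _) _; rewrite size_iota.
rewrite leqNgt; apply/negP => /(before_find 0).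
rewrite nth_iota // add0n /a => /existsP[]; exists (in_tuple p).
by rewrite pp eqxx.
Qed.

Lemma gdist_attained (G : graph) (x y : G) : connect (@adj G) x y ->
  exists p, [/\ path (@adj G) x p, last x p = y & size p = gdist x y].
Proof.
move=> /connectP[p0 pp0 ->]; case/shortenP: pp0 => p pp up _.
have sp : size p < #|G|.
  by have := max_card [in x :: p]; rewrite (card_uniqP up).
rewrite /gdist; set a := (X in find X _).
have ha : has a (iota 0 #|G|).
  apply/hasP; exists (size p); first by rewrite mem_iota.
  by apply/existsP; exists (in_tuple p); rewrite pp eqxx.
have := nth_find 0 ha; move: ha; rewrite has_find size_iota => lt.
rewrite nth_iota // add0n => /existsP[q /andP[pq /eqP lq]].
by exists q; rewrite size_tuple.
Qed.

(* Comparing enum_rank's selects one orientation of each edge. *)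
Definition WLf (G T : graph) (f : G -> T) : nat :=
  \sum_(e : G * G | adj e.1 e.2 && (enum_rank e.1 < enum_rank e.2))
     gdist (f e.1) (f e.2).

Definition bijb (V W : finType) (f : {ffun V -> W}) : bool :=
  injectiveb f && (#|W| <= #|V|).

Lemma bijP (V W : finType) (f : {ffun V -> W}) :
  reflect (bijective f) (bijb f).
Proof.
apply: (iffP andP) => [[/injectiveP fi ?]|bf]; first exact: inj_card_bij.
by split; [apply/injectiveP; apply: bij_inj | rewrite (bij_eq_card bf)].
Qed.

(* The unit of the iterated minimum is the maximum over the same range, so
   this is the true minimum as soon as a bijection exists (lemma WLP). *)
Definition WL (G T : graph) : nat :=
  let M := \max_(f : {ffun G -> T} | bijb f) WLf f in
  \big[minn/M]_(f : {ffun G -> T} | bijb f) WLf f.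

Lemma WLf_ext (G T : graph) (f g : G -> T) : f =1 g -> WLf f = WLf g.
Proof. by move=> fg; apply: eq_bigr => e _; rewrite !fg. Qed.

Lemma WLP (G T : graph) (f0 : G -> T) : bijective f0 ->
  (forall f : G -> T, bijective f -> WL G T <= WLf f) /\
  (exists2 f : G -> T, bijective f & WLf f = WL G T).
Proof.
move=> bf0.
have bb (f : G -> T) : bijective f -> bijb (finfun f).
  move=> bf; apply/bijP; apply: eq_bij bf _ _ => x; by rewrite ffunE.
have lb (f : G -> T) : bijective f -> WL G T <= WLf f.
  move=> bf; rewrite (@WLf_ext _ _ f (finfun f)) => [|x]; last by rewrite ffunE.
  rewrite /WL /=; set M := \max_(_ | _) _; clearbody M.
  have := mem_index_enum (finfun f); elim: (index_enum _) => //= g r IH.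
  rewrite inE big_cons => /predU1P[<-|/IH h]; first by rewrite bb // geq_minl.
  by case: ifP => // _; rewrite geq_min h orbT.
split=> //.
have att : exists2 f : {ffun G -> T}, bijb f & WLf f = \max_(f : {ffun G -> T} | bijb f) WLf f.
  have c : 0 < #|[pred f : {ffun G -> T} | bijb f]|.
    by apply/card_gt0P; exists (finfun f0); apply: bb.
  by have [f bf ->] := eq_bigmax_cond (fun f : {ffun G -> T} => WLf f) c; exists f.
suff [f bf <-] : exists2 f : {ffun G -> T}, bijb f & WLf f = WL G T.
  by exists f => //; apply/bijP.
rewrite /WL /=; move: att; set M := \max_(_ | _) _ => att.
apply: (big_ind (fun w => exists2 f : {ffun G -> T}, bijb f & WLf f = w)) => //.
  by move=> a b ea eb; rewrite /minn; case: ifP.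
by move=> f bf; exists f.
Qed.

(* The coordinate x_i of (x_{n-1}, ..., x_0) is x i. *)
Definition Q3_adj (n : nat) (x y : {ffun 'I_n -> 'I_3}) : bool :=
  [exists j, [&& x j != y j,
     (x j == y j + 1 %[mod 3]) || (x j + 1 == y j %[mod 3]) &
     [forall k, (k != j) ==> (x k == y k)]]].

Lemma Q3_sym n : symmetric (@Q3_adj n).
Proof.
move=> x y; apply: eq_existsb => j; rewrite [x j == y j]eq_sym; congr [&& _, _ & _].
  by rewrite orbC [x j + 1 == _ %[mod _]]eq_sym [x j == _ + _ %[mod _]]eq_sym.
by apply: eq_forallb => k; rewrite [x k == y k]eq_sym.
Qed.

Lemma Q3_irrefl n : irreflexive (@Q3_adj n).
Proof. by move=> x; apply/existsP => -[j]; rewrite eqxx. Qed.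

Definition Q3 (n : nat) : graph := Graph (@Q3_sym n) (@Q3_irrefl n).

(* (r, 0), (r, 1), (r, 2) stand for a_{r+1}, c_{r+1}, b_{r+1}. *)
Definition fc_arc (m : nat) (u v : 'I_m * 'I_3) : bool :=
  [|| [&& u.1 == v.1, u.2 == 0 :> nat & v.2 == 1 :> nat],
      [&& u.1 == v.1, u.2 == 1 :> nat & v.2 == 2 :> nat] |
      [&& u.1.+1 == v.1 :> nat, u.2 == 0 :> nat & v.2 == 0 :> nat]].

Definition fc_adj (m : nat) (u v : 'I_m * 'I_3) : bool := fc_arc u v || fc_arc v u.

Lemma fc_sym m : symmetric (@fc_adj m).
Proof. by move=> u v; rewrite /fc_adj orbC. Qed.

Lemma fc_irrefl m : irreflexive (@fc_adj m).
Proof. by move=> [r s]; rewrite /fc_adj /fc_arc /=; lia. Qed.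

Definition firecracker3 (m : nat) : graph := Graph (@fc_sym m) (@fc_irrefl m).

Lemma fc_connected m (u v : firecracker3 m) : connect (@adj (firecracker3 m)) u v.
Proof.
have cs : connect_sym (@adj (firecracker3 m)) by apply: sym_connect_sym; apply: fc_sym.
have C : forall (r : 'I_m) (s : 'I_3),
    connect (@adj (firecracker3 m)) (r, ord0) (r, s).
  move=> r s; have a1 : connect (@adj (firecracker3 m)) (r, ord0) (r, inord 1).
    by apply: connect1; rewrite /= /fc_adj /fc_arc /= eqxx inordK.
  have a2 : connect (@adj (firecracker3 m)) (r, inord 1) (r, inord 2).
    by apply: connect1; rewrite /= /fc_adj /fc_arc /= eqxx !inordK.
  case: s => -[|[|[|//]]] h.
  - by rewrite (_ : Ordinal h = ord0) ?connect0 //; apply: val_inj.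
  - by rewrite (_ : Ordinal h = inord 1) //; apply: val_inj; rewrite /= inordK.
  - rewrite (_ : Ordinal h = inord 2); last by apply: val_inj; rewrite /= inordK.
    exact: connect_trans a2.
have A : forall k (r r' : 'I_m), r' = r + k :> nat ->
    connect (@adj (firecracker3 m)) (r, ord0) (r', ord0).
  elim=> [|k IH] r r' e.
    by rewrite (_ : r' = r) ?connect0 //; apply: val_inj; rewrite /= e addn0.
  have h : r + k < m by have := ltn_ord r'; lia.
  apply: connect_trans (IH r (Ordinal h) erefl) _; apply: connect1.
  by rewrite /= /fc_adj /fc_arc /= e addnS eqxx !orbT.
case: u v => [r s] [r' s'].
apply: connect_trans (connect_trans _ (C r' s')); first by rewrite cs; apply: C.
case: (leqP r r') => h; first by apply: (A (r' - r)); lia.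
by rewrite cs; apply: (A (r - r')); lia.
Qed.

Definition fc_label (m : nat) (v : firecracker3 m) : nat := 3 * v.1 + v.2.

Definition Q3_code (n : nat) (x : Q3 n) : nat := \sum_(i < n) x i * 3 ^ i.

Lemma Q3_code_recr n (x : Q3 n.+1) : Q3_code x =
  @Q3_code n [ffun i => x (widen_ord (leqnSn n) i)] + x ord_max * 3 ^ n.
Proof.
rewrite /Q3_code big_ord_recr /=; congr (_ + _).
by apply: eq_bigr => i _; rewrite ffunE.
Qed.

Lemma Q3_code_lt n (x : Q3 n) : Q3_code x < 3 ^ n.
Proof.
elim: n x => [|n IH] x; first by rewrite /Q3_code big_ord0.
rewrite Q3_code_recr expnS; set y := finfun _.
by have := IH y; have := ltn_ord (x ord_max); nia.
Qed.

Lemma lex_proof n (x : Q3 n) : Q3_code x %/ 3 < 3 ^ n.-1.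
Proof.
have := Q3_code_lt x; case: n x => [|n] x /=; first by case: (Q3_code x).
by rewrite expnS ltn_divLR // mulnC.
Qed.

(* The vertex labelled Q3_code x (lemmas lex_label and fc_label_inj). *)
Definition lex (n : nat) (x : Q3 n) : firecracker3 (3 ^ n.-1) :=
  (Ordinal (lex_proof x), inord (Q3_code x %% 3)).

Lemma lex_label n (x : Q3 n) : fc_label (lex x) = Q3_code x.
Proof. by rewrite /fc_label /= inordK ?ltn_pmod // mulnC -divn_eq. Qed.

Lemma fc_label_inj m : injective (@fc_label m).
Proof.
move=> [r s] [r' s']; rewrite /fc_label /= => e.
have [h h'] := (ltn_ord s, ltn_ord s').
by congr (_, _); apply: val_inj => /=; lia.
Qed.

Lemma Q3_code_inj n : injective (@Q3_code n).
Proof.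
elim: n => [|n IH] x y; first by move=> _; apply/ffunP => -[].
pose w (z : Q3 n.+1) : Q3 n := [ffun i => z (widen_ord (leqnSn n) i)].
rewrite !Q3_code_recr -/(w x) -/(w y) => e.
have [lx ly] := (Q3_code_lt (w x), Q3_code_lt (w y)).
have em : x ord_max = y ord_max :> nat by nia.
have ew : w x = w y by apply: IH; rewrite em in e; move/addIn: e.
apply/ffunP => i; case: (unliftP ord_max i) => [j ->|->]; last exact: val_inj.
have := congr1 (fun z : {ffun _ -> _} => z j) ew; rewrite !ffunE.
by rewrite (_ : widen_ord _ j = lift ord_max j) //; apply: val_inj; rewrite /= /bump leqNgt ltn_ord.
Qed.

Lemma lex_bij n : 0 < n -> bijective (@lex n).
Proof.
move=> n0; apply: inj_card_bij.
  by move=> x y e; apply: Q3_code_inj; rewrite -!lex_label e.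
by rewrite card_prod card_ffun !card_ord -expnSr prednK.
Qed.

(* Main.v *)
Require Import Defs.
From mathcomp Require Import all_boot.
From mathcomp Require Import zify.
Set Implicit Arguments. Unset Strict Implicit. Unset Printing Implicit Defensive.

(* The wirelength is the sum, over the edges of the tree, of the edge boundary
   of the preimage of one of the two components left when that edge is deleted.
   We show that lex minimises every summand separately. Slicing a set A of
   vertices of Q_(n+1)^3 along x_0 into sets of sizes x, y, z, the boundary of A
   is the sum of the boundaries of the slices plus the sizes of their pairwise
   symmetric differences, hence at least the sum of the optimal boundaries plus
   |x-y| + |x-z| + |y-z|, with equality for nested optimal slices. An induction
   cutting x, y, z themselves into thirds shows that the balanced choice of
   x, y, z is the best one, so initial segments of the lexicographic order are
   optimal; so are the sets {3r+2} and {3r+1, 3r+2}, which the same slicing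
   computes. *)

(** * Arithmetic of the recursion for [mincut] *)

Definition dist (x y : nat) : nat := (x - y) + (y - x).

Definition pairdist (x y z : nat) : nat := dist x y + dist x z + dist y z.

(* The edge boundary of the first k vertices of Q_n^3 in lexicographic order:
   their slices along x_0 are nested initial segments of Q_(n-1)^3 whose sizes
   are as equal as possible. *)
Fixpoint mincut (n k : nat) : nat :=
  if n is n'.+1 then
    let x := (k + 2) %/ 3 in let y := (k + 1) %/ 3 in let z := k %/ 3 in
    mincut n' x + mincut n' y + mincut n' z + pairdist x y z
  else 0.

(** [pairdist] is twice the maximum minus the minimum, so the bound 2 forces [x], [y], [z] to be the
    three rounded thirds of their sum, up to order. *)
Lemma mincut_balanced n x y z : pairdist x y z <= 2 ->
  mincut n.+1 (x + y + z)
    = mincut n x + mincut n y + mincut n z + pairdist x y z.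
Proof.
rewrite /pairdist /dist => h /=.
pose m := (x + y + z) %/ 3; pose m1 := (x + y + z + 1) %/ 3.
pose m2 := (x + y + z + 2) %/ 3.
have [ex ey ez] : [/\ x = m \/ x = m.+1, y = m \/ y = m.+1
                    & z = m \/ z = m.+1] by rewrite /m; split; lia.
have e1 : m1 = m \/ m1 = m.+1 by rewrite /m1 /m; lia.
have e2 : m2 = m \/ m2 = m.+1 by rewrite /m2 /m; lia.
have sum : m2 + m1 + m = x + y + z by rewrite /m2 /m1 /m; lia.
have mono : m <= m1 <= m2 by rewrite /m2 /m1 /m; lia.
rewrite -/m -/m1 -/m2; clearbody m m1 m2.
by case: ex => ?; case: ey => ?; case: ez => ?; case: e1 => ?; case: e2 => ?;
  subst; rewrite /pairdist /dist; lia.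
Qed.

(** If [a < b], no carry reverses the order: the first three distances add up to the distance of the
    totals, and the triangle inequality bounds the fourth. If [a = b], both sides agree. *)
Lemma dist_thirds a b (p q r u v w : bool) :
  dist (a + p) (b + u) + dist (a + q) (b + v) + dist (a + r) (b + w)
    + dist (p + q + r) (u + v + w)
  <= dist (3 * a + (p + q + r)) (3 * b + (u + v + w))
     + (dist p u + dist q v + dist r w).
Proof.
rewrite /dist; case: (ltngtP a b) => [h|h|->].
- by case: p q r u v w => -[] [] [] [] []; lia.
- by case: p q r u v w => -[] [] [] [] []; lia.
- by case: p q r u v w => -[] [] [] [] []; lia.
Qed.

Lemma distD c x y : dist (c + x) (c + y) = dist x y.
Proof. by rewrite /dist !subnDl. Qed.

(* The worst case is a = b = c, which is the hypothesis. *)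
Lemma pairdist_thirds a b c (p0 p1 p2 q0 q1 q2 r0 r1 r2 : bool) :
  pairdist (p0 + q0 + r0) (p1 + q1 + r1) (p2 + q2 + r2)
    + (pairdist p0 q0 r0 + pairdist p1 q1 r1 + pairdist p2 q2 r2)
  <= pairdist p0 p1 p2 + pairdist q0 q1 q2 + pairdist r0 r1 r2
     + pairdist (p0 + p1 + p2) (q0 + q1 + q2) (r0 + r1 + r2) ->
  pairdist ((a + p0) + (b + q0) + (c + r0)) ((a + p1) + (b + q1) + (c + r1))
           ((a + p2) + (b + q2) + (c + r2))
    + (pairdist (a + p0) (b + q0) (c + r0) + pairdist (a + p1) (b + q1) (c + r1)
       + pairdist (a + p2) (b + q2) (c + r2))
  <= pairdist (a + p0) (a + p1) (a + p2) + pairdist (b + q0) (b + q1) (b + q2)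
     + pairdist (c + r0) (c + r1) (c + r2)
     + pairdist (3 * a + (p0 + p1 + p2)) (3 * b + (q0 + q1 + q2))
                (3 * c + (r0 + r1 + r2)).
Proof.
have E p q r : (a + p) + (b + q) + (c + r) = (a + b + c) + (p + q + r) by lia.
rewrite !E /pairdist !distD.
have := dist_thirds a b p0 p1 p2 q0 q1 q2.
have := dist_thirds a c p0 p1 p2 r0 r1 r2.
have := dist_thirds b c q0 q1 q2 r0 r1 r2.
lia.
Qed.

(* The carries of the thirds of x, y and z are placed in consecutive positions
   modulo 3, so that the thirds of x + y + z are again balanced. *)
Lemma balanced_thirds x y z : exists X Y Z : nat -> nat,
  [/\ [/\ x = X 0 + X 1 + X 2, y = Y 0 + Y 1 + Y 2 & z = Z 0 + Z 1 + Z 2],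
      [/\ pairdist (X 0) (X 1) (X 2) <= 2, pairdist (Y 0) (Y 1) (Y 2) <= 2
        & pairdist (Z 0) (Z 1) (Z 2) <= 2],
      pairdist (X 0 + Y 0 + Z 0) (X 1 + Y 1 + Z 1) (X 2 + Y 2 + Z 2) <= 2
    & pairdist (X 0 + Y 0 + Z 0) (X 1 + Y 1 + Z 1) (X 2 + Y 2 + Z 2)
      + (pairdist (X 0) (Y 0) (Z 0) + pairdist (X 1) (Y 1) (Z 1)
         + pairdist (X 2) (Y 2) (Z 2))
      <= pairdist (X 0) (X 1) (X 2) + pairdist (Y 0) (Y 1) (Y 2)
         + pairdist (Z 0) (Z 1) (Z 2) + pairdist x y z].
Proof.
have dec w : exists a i, w = 3 * a + i /\ i < 3.
  by exists (w %/ 3), (w %% 3); lia.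
have [[a [i [-> hi]]] [[b [j [-> hj]]] [c [k [-> hk]]]]] :=
  (dec x, (dec y, dec z)).
(* The carries of [y] start at position [i], those of [z] at [i + j], modulo 3; the added 3 and 6
   keep the subtractions from truncating. *)
exists (fun t => a + (t < i)), (fun t => b + ((t + 3 - i) %% 3 < j)),
  (fun t => c + ((t + 6 - i - j) %% 3 < k)).
split.
- by split; lia.
- by rewrite /pairdist !distD; split; rewrite /dist; lia.
- by move: i hi j hj k hk; case=> [|[|[|//]]] _ [|[|[|//]]] _ [|[|[|//]]] _;
    rewrite /modn /= /pairdist /dist; lia.
- have [ei ej ek] : [/\ i = (0 < i) + (1 < i) + (2 < i),
     j = ((0 + 3 - i) %% 3 < j) + ((1 + 3 - i) %% 3 < j) + ((2 + 3 - i) %% 3 < j) &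
     k = ((0 + 6 - i - j) %% 3 < k) + ((1 + 6 - i - j) %% 3 < k)
         + ((2 + 6 - i - j) %% 3 < k)] by split; lia.
  have := @pairdist_thirds a b c (0 < i) (1 < i) (2 < i)
    ((0 + 3 - i) %% 3 < j) ((1 + 3 - i) %% 3 < j) ((2 + 3 - i) %% 3 < j)
    ((0 + 6 - i - j) %% 3 < k) ((1 + 6 - i - j) %% 3 < k)
    ((2 + 6 - i - j) %% 3 < k).
  rewrite -ei -ej -ek; apply; move: i hi j hj k hk {ei ej ek}.
  by case=> [|[|[|//]]] _ [|[|[|//]]] _ [|[|[|//]]] _.
Qed.

(** The thirds form a 3 by 3 array with row sums [x], [y], [z]. Rows and column sums are balanced,
    so [mincut] unfolds exactly on them; the induction hypothesis bounds each column. *)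
Lemma mincut_add3 n x y z : x <= 3 ^ n -> y <= 3 ^ n -> z <= 3 ^ n ->
  mincut n.+1 (x + y + z)
    <= mincut n x + mincut n y + mincut n z + pairdist x y z.
Proof.
elim: n x y z => [|n IH] x y z.
  by rewrite expn0; case: x y z => [|[|//]] [|[|//]] [|[|//]].
rewrite expnS => hx hy hz.
have [X [Y [Z [[ex ey ez] [bX bY bZ] bU ineq]]]] := balanced_thirds x y z.
have -> : x + y + z = (X 0 + Y 0 + Z 0) + (X 1 + Y 1 + Z 1) + (X 2 + Y 2 + Z 2).
  by rewrite ex ey ez; lia.
rewrite (mincut_balanced _ bU).
have := mincut_balanced n bX; rewrite -ex => ->.
have := mincut_balanced n bY; rewrite -ey => ->.
have := mincut_balanced n bZ; rewrite -ez => ->.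
have third s u v w : s = u + v + w -> s <= 3 * 3 ^ n ->
    pairdist u v w <= 2 -> [/\ u <= 3 ^ n, v <= 3 ^ n & w <= 3 ^ n].
  by rewrite /pairdist /dist; split; lia.
have [X0 X1 X2] := third _ _ _ _ ex hx bX.
have [Y0 Y1 Y2] := third _ _ _ _ ey hy bY.
have [Z0 Z1 Z2] := third _ _ _ _ ez hz bZ.
have := IH _ _ _ X0 Y0 Z0; have := IH _ _ _ X1 Y1 Z1; have := IH _ _ _ X2 Y2 Z2.
lia.
Qed.

#[local] Arguments adj : simpl never.

Lemma mincut0 n : mincut n 0 = 0.
Proof. by elim: n => //= n ->. Qed.

(** * Sizes and edge boundaries of vertex sets *)

Definition psize (T : finType) (A : pred T) : nat := \sum_x A x.

(** Only the direction leaving [A] counts, so each boundary edge is counted once. *)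
Definition cut (G : graph) (A : pred G) : nat :=
  \sum_(e : G * G) (adj e.1 e.2 && (A e.1 && ~~ A e.2)).

Lemma eq_cut (G : graph) (A B : pred G) : A =1 B -> cut A = cut B.
Proof. by move=> AB; apply: eq_bigr => e _; rewrite !AB. Qed.

Lemma eq_psize (T : finType) (A B : pred T) : A =1 B -> psize A = psize B.
Proof. by move=> AB; apply: eq_bigr => e _; rewrite AB. Qed.

Lemma psize_le (T : finType) (A : pred T) : psize A <= #|T|.
Proof. by rewrite -sum1_card; apply: leq_sum => x _; case: (A x). Qed.

Lemma psize_comp (S T : finType) (f : S -> T) (A : pred T) :
  bijective f -> psize (A \o f) = psize A.
Proof. by move=> bf; rewrite /psize (reindex f) //; apply: onW_bij. Qed.

Lemma leq_psizeB (T : finType) (A B : pred T) :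
  psize A - psize B <= psize (predD A B).
Proof.
rewrite leq_subLR /psize -big_split; apply: leq_sum => x _ /=.
by case: (A x); case: (B x).
Qed.

Lemma psizeB (T : finType) (A B : pred T) : subpred A B \/ subpred B A ->
  psize (predD A B) = psize A - psize B.
Proof.
case=> s.
  have le : psize A <= psize B.
    by apply: leq_sum => x _; case Ax: (A x) => //; rewrite (s _ Ax).
  rewrite [RHS](eqP (_ : _ == 0)) // /psize big1 // => x _ /=.
  by case Ax: (A x); rewrite ?andbF // (s _ Ax).
have -> : psize A = psize (predD A B) + psize B.
  rewrite /psize -big_split; apply: eq_bigr => x _ /=.
  by case Bx: (B x); [rewrite (s _ Bx) | case: (A x)].
by rewrite addnK.
Qed.

(** Links the orientation chosen in [WLf] to [cut]: the pairs in decreasing rank are folded onto the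
    increasing ones by swapping. *)
Lemma cut_orient (G : graph) (A : pred G) :
  \sum_(e : G * G | adj e.1 e.2 && (enum_rank e.1 < enum_rank e.2))
     (A e.1 (+) A e.2 : nat) = cut A.
Proof.
pose lt (e : G * G) := enum_rank e.1 < enum_rank e.2.
pose g (e : G * G) : nat := adj e.1 e.2 && (A e.1 && ~~ A e.2).
have -> : cut A = \sum_(e | lt e) g e + \sum_(e | ~~ lt e) g e.
  by rewrite /cut (bigID lt).
have -> : \sum_(e | ~~ lt e) g e = \sum_(e | lt e) g (e.2, e.1).
  rewrite (reindex (fun e : G * G => (e.2, e.1))) /=; last first.
    by apply: onW_bij; exists (fun e => (e.2, e.1)) => -[].
  rewrite [LHS]big_mkcond [RHS]big_mkcond /=; apply: eq_bigr => -[x y] _.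
  rewrite /lt /g /= -leqNgt leq_eqVlt.
  case: (enum_rank x =P enum_rank y :> nat) => // e.
  have -> : x = y by apply: enum_rank_inj; apply: val_inj.
  by rewrite adj_irrefl /= ltnn.
rewrite -big_split [LHS]big_mkcond [RHS]big_mkcond /=.
apply: eq_bigr => -[x y] _; rewrite /lt /g /= [adj y x]adj_sym.
by case: (adj x y); case: ltnP => //=; case: (A x); case: (A y).
Qed.

(** * Slices along [x_0] and the isoperimetric inequality *)

Definition qcons n (d : 'I_3) (y : Q3 n) : Q3 n.+1 :=
  [ffun i => if unlift ord0 i is Some j then y j else d].

Lemma qcons0 n d (y : Q3 n) : qcons d y ord0 = d.
Proof. by rewrite ffunE unlift_none. Qed.

Lemma qconsS n d (y : Q3 n) j : qcons d y (lift ord0 j) = y j.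
Proof. by rewrite ffunE liftK. Qed.

Lemma qcons_bij n : bijective (fun p : 'I_3 * Q3 n => qcons p.1 p.2).
Proof.
exists (fun x : Q3 n.+1 => (x ord0, [ffun j => x (lift ord0 j)] : Q3 n)).
  move=> [d y] /=; rewrite qcons0; congr (_, _).
  by apply/ffunP => j; rewrite ffunE qconsS.
move=> x /=; apply/ffunP => i; case: (unliftP ord0 i) => [j|] ->.
  by rewrite qconsS ffunE.
by rewrite qcons0.
Qed.

Lemma big_qcons n (F : Q3 n.+1 -> nat) :
  \sum_x F x = \sum_d \sum_(y : Q3 n) F (qcons d y).
Proof.
by rewrite pair_big (reindex _ (onW_bij _ (@qcons_bij n))).
Qed.

(** Distinct residues modulo 3 always differ by 1 or -1, so this is the Hamming graph. *)
Lemma Q3_adjE n (x y : Q3 n) : adj x y =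
  [exists j, (x j != y j) && [forall k, (k != j) ==> (x k == y k)]].
Proof.
apply: eq_existsb => j; case: eqP => //= ne; rewrite andb_idl // => _.
have {ne} : x j != y j :> nat by apply/eqP => /val_inj.
by case: (x j) (y j) => [[|[|[|//]]] ?] [[|[|[|//]]] ?].
Qed.

Lemma adj_qcons n d e (y z : Q3 n) :
  adj (qcons d y) (qcons e z) = if d == e then adj y z else y == z.
Proof.
rewrite !Q3_adjE; case: (eqVneq d e) => [<-|ne].
  apply/existsP/existsP => -[j /andP[nj /forallP aj]].
    case: (unliftP ord0 j) nj aj => [i|] ->; last by rewrite !qcons0 eqxx.
    rewrite !qconsS => nj aj; exists i; rewrite nj; apply/forallP => k.
    have := aj (lift ord0 k); rewrite !qconsS.
    by rewrite (inj_eq (@lift_inj _ ord0)).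
  exists (lift ord0 j); rewrite !qconsS nj; apply/forallP => k.
  case: (unliftP ord0 k) => [i|] ->; last by rewrite !qcons0 eqxx implybT.
  by rewrite !qconsS (inj_eq (@lift_inj _ ord0)); apply: aj.
apply/existsP/eqP => [[j /andP[nj /forallP aj]]|->].
  case: (unliftP ord0 j) nj aj => [i|] -> nj aj.
    by have := aj ord0; rewrite !qcons0 (negPf ne) implybF negbK.
  apply/ffunP => k; have := aj (lift ord0 k); rewrite !qconsS => /implyP a.
  by apply/eqP; apply: a.
exists ord0; rewrite !qcons0 ne; apply/forallP => k.
case: (unliftP ord0 k) => [i|] ->; first by rewrite !qconsS eqxx implybT.
by rewrite eqxx.
Qed.

Lemma Q3_code_qcons n d (y : Q3 n) : Q3_code (qcons d y) = d + 3 * Q3_code y.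
Proof.
rewrite /Q3_code big_ord_recl qcons0 expn0 muln1 big_distrr /=; congr (_ + _).
by apply: eq_bigr => i _; rewrite qconsS /bump /= add1n expnS; lia.
Qed.

Definition slice n (A : pred (Q3 n.+1)) (d : nat) : pred (Q3 n) :=
  fun y => A (qcons (inord d) y).

Lemma sum_ord3 (F : 'I_3 -> nat) :
  \sum_d F d = F (inord 0) + F (inord 1) + F (inord 2).
Proof.
rewrite !big_ord_recl big_ord0 addn0 addnA.
by congr (F _ + F _ + F _); apply: val_inj; rewrite /= inordK.
Qed.

Lemma psize_slice n (A : pred (Q3 n.+1)) :
  psize A = psize (slice A 0) + psize (slice A 1) + psize (slice A 2).
Proof. by rewrite /psize big_qcons sum_ord3. Qed.

Definition slice_diff n (A : pred (Q3 n.+1)) (d e : nat) : nat :=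
  psize (predD (slice A d) (slice A e)).

(** Two different slices are joined by the perfect matching [y == z], so the edges leaving [A] from
    one to the other are counted by a set difference. *)
Lemma cut_slice n (A : pred (Q3 n.+1)) :
  cut A = cut (slice A 0) + cut (slice A 1) + cut (slice A 2)
    + (slice_diff A 0 1 + slice_diff A 1 0
       + (slice_diff A 0 2 + slice_diff A 2 0)
       + (slice_diff A 1 2 + slice_diff A 2 1)).
Proof.
pose F (d e : 'I_3) : nat := \sum_(y : Q3 n) \sum_(z : Q3 n)
  (adj (qcons d y) (qcons e z) && (A (qcons d y) && ~~ A (qcons e z))).
have same d : F (inord d) (inord d) = cut (slice A d).
  rewrite /cut /F pair_big; apply: eq_bigr => -[y z] _ /=.
  by rewrite adj_qcons eqxx.
have diff d e : d < 3 -> e < 3 -> d != e ->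
    F (inord d) (inord e) = slice_diff A d e.
  move=> hd he ne; apply: eq_bigr => y _; rewrite (bigD1 y) //= big1.
    rewrite adj_qcons -val_eqE /= !inordK // (negPf ne) eqxx addn0 /=.
    by rewrite andbC.
  move=> z zy; rewrite adj_qcons -val_eqE /= !inordK // (negPf ne).
  by rewrite eq_sym (negPf zy).
have -> : cut A = \sum_d \sum_e F d e.
  rewrite /cut -(pair_big xpredT xpredT (fun x y =>
    (adj x y && (A x && ~~ A y)) : nat)) /= big_qcons.
  apply: eq_bigr => d _; rewrite exchange_big big_qcons /=.
  by apply: eq_bigr => e _; rewrite exchange_big.
by rewrite !sum_ord3 !same !diff //; lia.
Qed.

Lemma cut_ge n (A : pred (Q3 n)) : mincut n (psize A) <= cut A.
Proof.
elim: n A => [//|n IH] A; rewrite cut_slice psize_slice.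
have sz (B : pred (Q3 n)) : psize B <= 3 ^ n.
  by have := psize_le B; rewrite card_ffun !card_ord.
apply: leq_trans (mincut_add3 (sz _) (sz _) (sz _)) _.
by apply: leq_add; rewrite ?leq_add ?IH ?leq_psizeB.
Qed.

Lemma cut_nested n (A : pred (Q3 n.+1)) :
  (forall d e, subpred (slice A d) (slice A e)
            \/ subpred (slice A e) (slice A d)) ->
  cut A = cut (slice A 0) + cut (slice A 1) + cut (slice A 2)
    + pairdist (psize (slice A 0)) (psize (slice A 1)) (psize (slice A 2)).
Proof. by move=> h; rewrite cut_slice /slice_diff !psizeB. Qed.

(** * Sets whose boundary attains [mincut] *)

Lemma cut_prefix n k : k <= 3 ^ n ->
  psize (fun x : Q3 n => Q3_code x < k) = k /\
  cut (fun x : Q3 n => Q3_code x < k) = mincut n k.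
Proof.
elim: n k => [|n IH] k.
  have z (x : Q3 0) : Q3_code x = 0 by rewrite /Q3_code big_ord0.
  rewrite expn0 => hk; split.
    rewrite /psize; under eq_bigr => x _ do rewrite z.
    rewrite sum_nat_const card_ffun !card_ord expn0 mul1n.
    by case: k hk => [|[|]].
  by rewrite /cut big1 // => -[x y] _; rewrite !z; case: (0 < k); rewrite andbF.
set A := fun _ => _; rewrite expnS => hk.
(* [d + 3 * c < k] means that [c] is below [k - d] over 3, rounded up. *)
have sl d : d < 3 -> slice A d =1 (fun x : Q3 n => Q3_code x < (k + (2 - d)) %/ 3).
  move=> hd y; rewrite /slice /A Q3_code_qcons inordK //; apply/idP/idP; lia.
have s d : d < 3 -> psize (slice A d) = (k + (2 - d)) %/ 3
      /\ cut (slice A d) = mincut n ((k + (2 - d)) %/ 3).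
  move=> hd; rewrite (eq_psize (sl d hd)) (eq_cut (sl d hd)).
  by apply: IH; lia.
have [[p0 c0] [p1 c1] [p2 c2]] := And3 (s 0 isT) (s 1 isT) (s 2 isT).
split; first by rewrite psize_slice p0 p1 p2; lia.
rewrite cut_nested ?p0 ?p1 ?p2 ?c0 ?c1 ?c2 /= ?addn0 //.
move=> d e; case: (leqP (@inord 2 d) (@inord 2 e)) => h; [right|left] => y;
  rewrite /slice /A !Q3_code_qcons; lia.
Qed.

(** Each slice is empty or the point of code [r], so the slices are nested and their sizes balanced.
    This serves single points and the sides of the leg edges. *)
Lemma cut_block n r (D : pred nat) : r < 3 ^ n ->
  psize (fun y : Q3 n => Q3_code y == r) = 1 ->
  cut (fun y : Q3 n => Q3_code y == r) = mincut n 1 ->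
  let A := fun x : Q3 n.+1 => (Q3_code x %/ 3 == r) && D (Q3_code x %% 3) in
  psize A = D 0 + D 1 + D 2 /\ cut A = mincut n.+1 (D 0 + D 1 + D 2).
Proof.
move=> hr p1 c1 A.
have sl d : d < 3 -> slice A d =1 (fun y : Q3 n => D d && (Q3_code y == r)).
  move=> hd y; rewrite /slice /A Q3_code_qcons inordK // andbC.
  by rewrite (_ : (_ + _) %% 3 = d) 1?(_ : (_ + _) %/ 3 = Q3_code y) //; lia.
have s d : d < 3 -> psize (slice A d) = D d /\ cut (slice A d) = mincut n (D d).
  move=> hd; rewrite (eq_psize (sl d hd)) (eq_cut (sl d hd)).
  case: (D d) => //=; rewrite mincut0; split; first by rewrite /psize big1.
  by rewrite /cut big1 // => e _; rewrite andbF.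
have [[p0 c0] [q1 d1] [p2 c2]] := And3 (s 0 isT) (s 1 isT) (s 2 isT).
split; first by rewrite psize_slice p0 q1 p2.
rewrite cut_nested ?p0 ?q1 ?p2 ?c0 ?d1 ?c2.
  by rewrite mincut_balanced //; case: (D 0) (D 1) (D 2) => -[] [].
(* Nestedness is asked for every natural [d]; [slice] reads it through [inord], which sends values
   out of range to 0. *)
have sl' d y : slice A d y = D (@inord 2 d) && (Q3_code y == r).
  have := sl (@inord 2 d) (ltn_ord _) y.
  by rewrite /slice inord_val => ->.
move=> d e; case De: (D (@inord 2 e)).
  by left=> y; rewrite !sl' De => /andP[_ ->].
by right=> y; rewrite !sl' De.
Qed.

Lemma cut_point n r : r < 3 ^ n ->
  psize (fun y : Q3 n => Q3_code y == r) = 1 /\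
  cut (fun y : Q3 n => Q3_code y == r) = mincut n 1.
Proof.
elim: n r => [|n IH] r.
  rewrite expn0 ltnS leqn0 => /eqP->.
  have z (x : Q3 0) : Q3_code x = 0 by rewrite /Q3_code big_ord0.
  split; last by rewrite /cut big1 // => -[x y] _; rewrite !z andbF.
  rewrite /psize; under eq_bigr => x _ do rewrite z.
  by rewrite sum_nat_const card_ffun !card_ord expn0.
rewrite expnS => hr; have hq : r %/ 3 < 3 ^ n by lia.
have [p c] := IH _ hq.
have := @cut_block n (r %/ 3) (pred1 (r %% 3)) hq p c.
set A := fun _ => _; set B := fun _ => _ => /= -[].
have AB : A =1 B by move=> x; rewrite /A /B /=; apply/andP/eqP; lia.
rewrite (eq_cut AB) (eq_psize AB) => -> ->.
have : r %% 3 < 3 by rewrite ltn_pmod.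
by case: (r %% 3) => [|[|[|]]].
Qed.

(** * Distances in the firecracker as sums over its edges *)

Definition fcdist m (u v : firecracker3 m) : nat :=
  if u.1 == v.1 then dist u.2 v.2 else u.2 + v.2 + dist u.1 v.1.

Lemma fcdist_adj m (u v w : firecracker3 m) :
  adj u v -> fcdist u w <= (fcdist v w).+1.
Proof.
case: u v w => [[r hr] [s hs]] [[r' hr'] [s' hs']] [[r'' hr''] [s'' hs'']].
rewrite /adj /= /fcdist /fc_adj /fc_arc /dist /= -!val_eqE /=.
by case: (eqVneq r r'') => ?; case: (eqVneq r' r'') => ?; lia.
Qed.

Lemma fcdist_next m (u v : firecracker3 m) k : fcdist u v = k.+1 ->
  exists2 w, adj u w & fcdist w v = k.
Proof.
case: u v => [[r hr] [s hs]] [[r' hr'] [s' hs']].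
rewrite /= /fcdist /dist /= -val_eqE /=.
(* The two alternatives are a step along a leg and a step along the spine. *)
have go r1 (h1 : r1 < m) s1 (h2 : s1 < 3) :
    (r = r1 /\ (s1 = s.+1 \/ s = s1.+1)) \/
    (s = 0 /\ s1 = 0 /\ (r1 = r.+1 \/ r = r1.+1)) ->
    (if r1 == r' then (s1 - s') + (s' - s1)
     else s1 + s' + ((r1 - r') + (r' - r1))) = k ->
    exists2 w : firecracker3 m, adj ((Ordinal hr, Ordinal hs) : firecracker3 m) w
      & fcdist w (Ordinal hr', Ordinal hs') = k.
  move=> h e; exists (Ordinal h1, Ordinal h2) => //.
  by rewrite /adj /= /fc_adj /fc_arc /= -!val_eqE /=; lia.
case: (eqVneq r r') => [e|ne] ek.
  case: (ltngtP s s') => h; last by lia.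
    have h2 : s.+1 < 3 by lia.
    by apply: (go r hr _ h2); [lia | rewrite e eqxx; lia].
  have h2 : s.-1 < 3 by lia.
  by apply: (go r hr _ h2); [lia | rewrite e eqxx; lia].
case: (posnP s) => s0.
  case: (ltngtP r r') => h; last by lia.
    have h1 : r.+1 < m by lia.
    by apply: (go _ h1 s hs); [lia | case: eqP => ?; lia].
  have h1 : r.-1 < m by lia.
  by apply: (go _ h1 s hs); [lia | case: eqP => ?; lia].
have h2 : s.-1 < 3 by lia.
by apply: (go r hr _ h2); [lia | rewrite (negPf ne); lia].
Qed.

(** [fcdist_next] builds a walk of length [fcdist]; by [fcdist_adj] no walk is shorter, as each step
    lowers [fcdist] by at most 1. *)
Lemma gdist_fc m (u v : firecracker3 m) : gdist u v = fcdist u v.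
Proof.
apply/eqP; rewrite eqn_leq; apply/andP; split.
  suff [p [pp <- <-]] : exists p, [/\ path (@adj _) u p, last u p = v
      & size p = fcdist u v] by apply: gdist_le.
  move e: (fcdist u v) => k; elim: k u e => [|k IH] u e.
    exists [::]; split=> //; move: e; rewrite /fcdist /dist.
    case: u v => [[r hr] [s hs]] [[r' hr'] [s' hs']] /=; rewrite -val_eqE /=.
    by case: eqP => [er|ne] e; [congr (_, _); apply: val_inj => /=; lia | lia].
  have [w uw /IH[p [pp lp sp]]] := fcdist_next e.
  by exists (w :: p); split=> //=; [apply/andP | rewrite sp].
have [p [pp <- <-]] := gdist_attained (fc_connected u v).
elim: p u pp => [|w p IH] u /=; first by rewrite /fcdist /dist eqxx subnn.
move=> /andP[uw pp]; apply: leq_trans (@fcdist_adj _ _ w _ uw) _.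
by rewrite ltnS; apply: IH.
Qed.

Lemma sum_sep_le m a b : a < m -> b < m ->
  \sum_(r < m) ((a <= r) (+) (b <= r) : nat) = dist a b.
Proof.
(* Truncating [a] and [b] at [m] gives a form that survives induction on [m]. *)
suff -> : \sum_(r < m) ((a <= r) (+) (b <= r) : nat) = dist (minn a m) (minn b m).
  by move=> ha hb; rewrite /dist; lia.
elim: m => [|m IH]; first by rewrite big_ord0 /dist; lia.
by rewrite big_ord_recr /= IH /dist; lia.
Qed.

Lemma sum_sep_eq m (a b : 'I_m) (s t : bool) :
  \sum_(r < m) (((a == r) && s) (+) ((b == r) && t) : nat)
    = if a == b then (s (+) t : nat) else s + t.
Proof.
have E (c : 'I_m) (x : bool) : \sum_(r < m) ((c == r) && x : nat) = x.
  rewrite (bigD1 c) //= eqxx big1 ?addn0 // => i; rewrite eq_sym => h.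
  by rewrite (negPf h).
case: eqVneq => [<-|ne].
  by rewrite -[RHS](E a); apply: eq_bigr => r _; case: eqP.
rewrite -[in RHS](E a s) -[X in _ + X](E b t) -big_split.
apply: eq_bigr => r _ /=; case: eqP => [<-|//].
by rewrite eq_sym (negPf ne) addbF addn0.
Qed.

(** A tree distance counts the edges separating its endpoints; the terms for [r] test the spine edge
    after leg [r] and the two edges of that leg. *)
Lemma fcdist_sep m (u v : firecracker3 m) : fcdist u v =
  \sum_(r < m) (((u.1 <= r) (+) (v.1 <= r) : nat)
    + (((u.1 == r) && (1 <= u.2)) (+) ((v.1 == r) && (1 <= v.2)) : nat)
    + (((u.1 == r) && (2 <= u.2)) (+) ((v.1 == r) && (2 <= v.2)) : nat)).
Proof.
rewrite !big_split /= !sum_sep_eq sum_sep_le // /fcdist.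
case: u v => [r [s hs]] [r' [s' hs']] /=.
by case: eqP => [<-|_]; rewrite /dist; lia.
Qed.

(* The components cut off by the edges a_r a_{r+1}, a_r c_r and c_r b_r are
   [spine_side r], [ray_side r 1] and [ray_side r 2]; for the last r,
   [spine_side r] is everything and contributes an empty cut. *)
Definition spine_side m (r : 'I_m) : pred (firecracker3 m) := fun v => v.1 <= r.

Definition ray_side m (r : 'I_m) (s : nat) : pred (firecracker3 m) :=
  fun v => (v.1 == r) && (s <= v.2).

Lemma WLf_cut m (G : graph) (f : G -> firecracker3 m) : WLf f =
  \sum_(r < m) (cut (spine_side r \o f) + cut (ray_side r 1 \o f)
                + cut (ray_side r 2 \o f)).
Proof.
rewrite /WLf; under eq_bigr => e _ do rewrite gdist_fc fcdist_sep.
rewrite exchange_big; apply: eq_bigr => r _ /=.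
by rewrite !big_split -!cut_orient.
Qed.

(** * Comparison of [lex] with an arbitrary bijection *)

Lemma lex_cut n (r : 'I_(3 ^ n)) :
  let lexn : Q3 n.+1 -> firecracker3 (3 ^ n) := @lex n.+1 in
  [/\ cut (spine_side r \o lexn) = mincut n.+1 (psize (spine_side r \o lexn)),
      cut (ray_side r 1 \o lexn) = mincut n.+1 (psize (ray_side r 1 \o lexn))
    & cut (ray_side r 2 \o lexn) = mincut n.+1 (psize (ray_side r 2 \o lexn))].
Proof.
move=> lexn; have hr := ltn_ord r.
have [p c] := cut_point hr.
have ray s : cut (ray_side r s \o lexn)
    = mincut n.+1 (psize (ray_side r s \o lexn)).
  have [] := @cut_block n r (leq s) hr p c.
  set A := fun _ => _ => pA cA.
  have e : ray_side r s \o lexn =1 A.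
    by move=> x; rewrite /ray_side /A /= inordK // ltn_pmod.
  by rewrite (eq_cut e) (eq_psize e) pA cA.
split=> //.
(* Legs 0 to [r] carry exactly the labels below [3 * r.+1]. *)
have [|] := @cut_prefix n.+1 (3 * r.+1); first by rewrite expnS; lia.
set A := fun _ => _ => pA cA.
have e : spine_side r \o lexn =1 A.
  by move=> x; rewrite /spine_side /A /=; apply/idP/idP; lia.
by rewrite (eq_cut e) (eq_psize e) pA cA.
Qed.

(** Preimages of [S] under bijections have equal size, so the value attained by [lex] is the lower
    bound of [cut_ge] for [f]. *)
Lemma lex_cut_le n (f : Q3 n.+1 -> firecracker3 (3 ^ n))
    (S : pred (firecracker3 (3 ^ n))) :
  bijective f ->
  cut (S \o @lex n.+1) = mincut n.+1 (psize (S \o @lex n.+1)) ->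
  cut (S \o @lex n.+1) <= cut (S \o f).
Proof.
move=> bf ->; rewrite (psize_comp S (lex_bij (ltn0Sn n))) -(psize_comp S bf); exact: cut_ge.
Qed.

Theorem theorem5p8 (n : nat) (hn : 1 <= n) :
  @WLf (Q3 n) (firecracker3 (3 ^ n.-1)) (@lex n) = WL (Q3 n) (firecracker3 (3 ^ n.-1)).
Proof.
have [lb [f bf ef]] := WLP (lex_bij hn).
apply/eqP; rewrite eqn_leq lb ?andbT; last exact: lex_bij.
rewrite -ef; case: n hn f bf {lb ef} => // n _ f bf.
rewrite !WLf_cut; apply: leq_sum => r _.
have [c0 c1 c2] := lex_cut r.
by rewrite !leq_add ?lex_cut_le.
Qed.
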